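(* Let $H=\sum_{X\in S}\lambda_Xh_X$ be a local Hamiltonian whose interaction graph has maximum degree $\mathfrak{d}\ge1$, let $|\Phi\rangle$ be a product state, and let $$t_{\mathrm{QSL}}=\min\{t\ge0:\langle\Phi|e^{-itH}|\Phi\rangle=0\}$$ (with $t_{\mathrm{QSL}}=\infty$ if the set is empty). Then $t_{\mathrm{QSL}}\ge t_L^*$, where $t_L^*=1/[2e^2\mathfrak{d}(\mathfrak{d}+1)]$.
   Context: $V$ is a set of $n$ spins; each $v\in V$ carries a Hilbert space $\mathcal{H}^v$ of dimension $d$, and $\mathcal{H}=\bigotimes_{v\in V}\mathcal{H}^v$. A subsystem is a subset $X\subseteq V$. The support of a linear operator is the smallest subsystem on which it acts nontrivially. $S$ is a set of subsystems with $|X|\le k$ for all $X\in S$, for some fixed $k$. $\lambda_X\in\mathbb{R}$ with $|\lambda_X|\le1$, and $h_X$ is Hermitian with support $X$ and operator norm $1$. The interaction graph is the simple graph with vertex set $S$ in which two distinct $X,Y\in S$ are joined by an edge iff $X\cap Y\ne\emptyset$; $\mathfrak{d}$ is its maximum degree. A (pure) product state is a unit vector $|\Phi\rangle=\bigotimes_{v\in V}|\phi_v\rangle$. *)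

(* Defs.v *)
From HB Require Import structures.
From mathcomp Require Import all_boot all_order all_algebra.
From mathcomp Require Import spectral sesquilinear complex.
From mathcomp Require Import all_classical all_reals all_analysis.

Set Implicit Arguments.
Unset Strict Implicit.
Unset Printing Implicit Defensive.

Import Order.TTheory GRing.Theory Num.Theory.
Import numFieldNormedType.Exports.

Local Open Scope classical_set_scope.
Local Open Scope complex_scope.
Local Open Scope sesquilinear_scope.
Local Open Scope ring_scope.

Section HilbertSpace.
Variables (R : realType) (n : nat).
Implicit Types (u v : 'cV[R[i]]_n) (A : 'M[R[i]]_n).

Definition inner u v : R[i] := (u ^t* *m v) ord0 ord0.

Definition vnorm u : R := Num.sqrt (complex.Re (inner u u)).

Definition opnorm A : R := sup [set vnorm (A *m u) | u in [set u | vnorm u <= 1]].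

(* The topology on matrices is that of entrywise convergence; R[i]^o carries
   the topology of the complex modulus. *)
Definition expmx A : 'M[R[i]]_n :=
  limn (series (fun k => (k`!%:R)^-1 *: A ^+ k : 'M[R[i]^o]_n)).

End HilbertSpace.

Section Spins.
Variables (R : realType) (d : nat).

(* Elements of [conf T] index the standard basis of the tensor product, over
   the spins in T, of copies of R[i]^d; vectors and operators are written in
   this basis. *)
Definition conf (T : finType) := {ffun T -> 'I_d}.
Definition ket (T : finType) := 'cV[R[i]]_#|conf T|.
Definition oper (T : finType) := 'M[R[i]]_#|conf T|.

Variable V : finType.
Implicit Types (X Y : {set V}) (A H : oper V) (Phi : ket V).

Definition restrict X (s : conf V) : conf {v : V | v \in X} :=
  [ffun v => s (val v)].

(* B tensored with the identity on the spins outside X. *)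
Definition extend X (B : oper {v : V | v \in X}) : oper V :=
  \matrix_(i, j)
    (B (enum_rank (restrict X (enum_val i)))
       (enum_rank (restrict X (enum_val j)))
     *+ [forall v, (v \notin X) ==> (enum_val i v == enum_val j v)]).

Definition acts_on X A : Prop := exists B : oper {v : V | v \in X}, A = extend B.

Definition has_support A X : Prop :=
  acts_on X A /\ forall Y, acts_on Y A -> X \subset Y.

Definition product_state Phi : Prop :=
  vnorm Phi = 1 /\
  exists phi : V -> 'cV[R[i]]_d,
    forall s : conf V, Phi (enum_rank s) ord0 = \prod_(v : V) phi v (s v) ord0.

Definition interaction_adj : rel {set V} :=
  [rel X Y : {set V} | (X != Y) && ~~ [disjoint X & Y]].

Definition interaction_degree (S : {set {set V}}) : nat :=
  \max_(X in S) #|[pred Y in S | interaction_adj X Y]|.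

Definition hamiltonian (S : {set {set V}}) (lam : {set V} -> R)
    (h : {set V} -> oper V) : oper V :=
  \sum_(X in S) (lam X)%:C *: h X.

Definition orthogonality_times H Phi : set R :=
  [set t | 0 <= t /\ inner Phi (expmx ((- 'i%C * t%:C) *: H) *m Phi) = 0].

(* T is the minimum of the orthogonality times, or +oo if there are none. *)
Definition is_tQSL H Phi (T : \bar R) : Prop :=
  (exists2 t, T = t%:E &
     orthogonality_times H Phi t /\
     (forall s, orthogonality_times H Phi s -> t <= s)) \/
  (orthogonality_times H Phi = set0 /\ T = +oo%E).

End Spins.

Definition tLstar (R : realType) (D : nat) : R :=
  (2 * expR 1 ^+ 2 * D%:R * (D%:R + 1))^-1.

(* Main.v *)
(* Write Z(B) for the amplitude <Phi|exp(-it H_B)|Phi> of the part H_B of the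
   Hamiltonian summed over a subset B of S, and W(A; B) for the part of the
   exponential series of Z(A u B) made of the words in which every letter of A
   occurs. Then W({}; B) = Z(B) and W(A; B + Y) = W(A; B) + W(A + Y; B).
   Since Phi is a product state, W(A; B) = W(A; {}) Z(B) when no element of A is
   adjacent to B, and counting words gives |W(A; {})| <= x^|A| with
   x = exp(t) - 1. Removing the neighbours of A from B one by one, induction on
   |B| yields
     |W(A; B)| <= x^|A| r^b |Z(B)|   and   (1 - x r^D) |Z(B - Y)| <= |Z(B)|,
   where b is the number of neighbours of A in B and D the maximum degree, as
   soon as 1 + x r^D <= r (1 - x r^D). The choice r = 1 + 1/D satisfies this for
   t <= t_L^*, so Z(S) does not vanish there. The first zero of the amplitude is
   attained because |Z(t) - Z(s)| <= exp(|S| t) - exp(|S| s) for s <= t. *)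
Require Import Defs.
From mathcomp Require Import all_boot all_order all_algebra.
From mathcomp Require Import spectral sesquilinear complex.
From mathcomp Require Import all_classical all_reals all_analysis.
From mathcomp Require Import ring lra.
Import Order.TTheory GRing.Theory Num.Theory.
Local Open Scope ring_scope.

Set Implicit Arguments.
Unset Strict Implicit.
Unset Printing Implicit Defensive.

Import numFieldNormedType.Exports.

Local Open Scope complex_scope.
Local Open Scope ring_scope.

(** * Complex exponential generating functions: limits, majorants and products *)

Section ExponentialGeneratingFunctions.
Local Open Scope classical_set_scope.
Local Open Scope ring_scope.
Variable R : realType.
Implicit Types (u v : nat -> R[i]) (z y : R[i]).

(** The annotation [R[i]^o] selects the topology of the complex modulus, which is also the one
    underlying [expmx]. *)
Definition clim u z := (u : nat -> R[i]^o) @ \oo --> (z : R[i]^o).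

Lemma climD u v y z : clim u y -> clim v z -> clim (u \+ v) (y + z).
Proof. exact: cvgD. Qed.

Lemma climB u v y z : clim u y -> clim v z -> clim (u \- v) (y - z).
Proof. exact: cvgB. Qed.

Lemma climM u v y z : clim u y -> clim v z -> clim (u \* v) (y * z).
Proof. exact: cvgM. Qed.

Lemma clim_cst z : clim (fun=> z) z.
Proof. exact: cvg_cst. Qed.

Lemma clim_real (u : nat -> R) (x : R) :
  u @ \oo --> x -> clim (fun n => (u n)%:C) x%:C.
Proof.
move=> /cvgrPdist_lt ux; apply/cvgrPdist_lt => e e0.
(* Positive elements of [R[i]] are real, so the complex tolerance [e] is its own real part. *)
have er : (complex.Re e)%:C = e by rewrite RRe_real // gtr0_real.
have /ux : 0 < complex.Re e by rewrite -ltcR er.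
apply: filterS => n; rewrite -ltcR er -rmorphB /=.
by rewrite normc_def /= expr0n addr0 sqrtr_sqr.
Qed.

Lemma clim_norm_le u z (c : R) :
  clim u z -> (forall n, `|u n| <= c%:C) -> `|z| <= c%:C.
Proof.
move=> /cvgrPdist_lt uz uc.
rewrite real_leNgt ?normr_real ?complex_real //; apply/negP => cz.
have /uz [N _ /(_ N (leqnn N))] : 0 < `|z| - c%:C by rewrite subr_gt0.
rewrite /= ltrBrDr => h.
have := le_lt_trans (lerD (lexx _) (uc N)) h.
by move/(le_lt_trans (ler_normD _ _)); rewrite subrK ltxx.
Qed.

Lemma clim_squeeze u z (e : nat -> R) :
  (forall n, `|z - u n| <= (e n)%:C) -> e @ \oo --> (0 : R) -> clim u z.
Proof.
move=> ue /clim_real /cvgrPdist_lt e0; apply/cvgrPdist_lt => d /e0.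
apply: filterS => n /=; apply: le_lt_trans; rewrite (le_trans (ue n)) //.
by rewrite sub0r normrN real_ler_norm // complex_real.
Qed.

Definition eseries (f : nat -> R[i]) : nat -> R[i] :=
  series (fun k => (k`!%:R)^-1 * f k).

Definition egf (f : nat -> R[i]) : R[i] := limn (eseries f : nat -> R[i]^o).

(** [limn] takes a default value on divergent sequences; under [ecvg], [egf f] is the actual sum. *)
Definition ecvg (f : nat -> R[i]) := clim (eseries f) (egf f).

Lemma egfE f z : clim (eseries f) z -> egf f = z.
Proof. exact: cvg_lim. Qed.

Lemma ecvgP f z : clim (eseries f) z -> ecvg f.
Proof. by move=> h; rewrite /ecvg (egfE h). Qed.

Lemma eseriesB f g : eseries (f \- g) = eseries f \- eseries g.
Proof.
apply/funext => n; rewrite /eseries /series /= -sumrB; apply: eq_bigr => k _.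
by rewrite mulrBr.
Qed.

Lemma egfB f g : ecvg f -> ecvg g -> ecvg (f \- g) /\ egf (f \- g) = egf f - egf g.
Proof.
move=> cf cg; have := climB cf cg; rewrite -eseriesB => h.
by split; [exact: ecvgP h | exact: egfE].
Qed.

Lemma eseries_le f (g : nat -> R) n :
  (forall k, `|f k| <= (g k)%:C) ->
  `|eseries f n| <= (series (fun k => (k`!%:R)^-1 * g k) n)%:C.
Proof.
move=> fg; rewrite /eseries /series /= rmorph_sum /=.
apply: (le_trans (ler_norm_sum _ _ _)); apply: ler_sum => k _.
rewrite rmorphM fmorphV rmorph_nat normrM normfV normr_nat.
by rewrite ler_wpM2l // invr_ge0 ler0n.
Qed.

(** The bound forces [g] to be nonnegative, so the partial sums of the majorant increase to [y] and
    stay below it. *)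
Lemma egf_norm_le f (g : nat -> R) (y : R) : ecvg f ->
  (forall k, `|f k| <= (g k)%:C) ->
  series (fun k => (k`!%:R)^-1 * g k) @ \oo --> y -> `|egf f| <= y%:C.
Proof.
move=> cf fg gy; apply: clim_norm_le (cf) _ => n.
apply: le_trans (eseries_le n fg) _; rewrite lecR.
have g0 k : 0 <= g k by rewrite -ler0c (le_trans _ (fg k)).
rewrite -(cvg_lim _ gy) //; apply: nondecreasing_cvgn_le.
  by apply: nondecreasing_series => k _ _; rewrite mulr_ge0 ?invr_ge0.
by apply/cvg_ex; exists y.
Qed.

Lemma cvg_series_expR (x : R) :
  series (fun k => (k`!%:R)^-1 * x ^+ k) @ \oo --> expR x.
Proof.
suff <- : exp_coeff x = fun k => (k`!%:R)^-1 * x ^+ k.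
  exact: is_cvg_series_exp_coeff.
by apply/funext => k; rewrite /exp_coeff /= mulrC.
Qed.

(** Real and imaginary parts are both dominated by the series of [expR K], so each converges
    absolutely. *)
Lemma ecvg_le_expr f (K : R) : (forall k, `|f k| <= (K ^+ k)%:C) -> ecvg f.
Proof.
move=> fK.
have aux (g : nat -> R) : (forall k, `|g k| <= K ^+ k) ->
    cvgn (series (fun k => (k`!%:R)^-1 * g k)).
  move=> gK; apply: normed_cvg.
  apply: (@series_le_cvg _ _ (fun k => (k`!%:R)^-1 * K ^+ k)) => [n|n|n|] //=.
  - by rewrite mulr_ge0 ?invr_ge0 // (le_trans _ (gK n)).
  - by rewrite normrM normfV normr_nat ler_wpM2l // invr_ge0.
  - by apply/cvg_ex; exists (expR K); exact: cvg_series_expR.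
have parts k : eseries f k = (series (fun k => (k`!%:R)^-1 * complex.Re (f k)) k)%:C
    + 'i%C * (series (fun k => (k`!%:R)^-1 * complex.Im (f k)) k)%:C.
  rewrite /eseries /series /= !rmorph_sum /= mulr_sumr -big_split /=.
  apply: eq_bigr => j _; rewrite !rmorphM fmorphV rmorph_nat.
  by rewrite mulrCA -mulrDr -complexE.
have /cvg_ex[x cx] : cvgn (series (fun k => (k`!%:R)^-1 * complex.Re (f k))).
  apply: aux => k; rewrite -lecR (le_trans _ (fK k)) //.
  exact: normc_ge_Re.
have /cvg_ex[y cy] : cvgn (series (fun k => (k`!%:R)^-1 * complex.Im (f k))).
  apply: aux => k; rewrite -lecR (le_trans _ (fK k)) //.
  rewrite normc_def lecR -[leLHS]sqrtr_sqr.
  by rewrite ler_wsqrtr // lerDr sqr_ge0.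
have := climD (clim_real cx) (climM (@clim_cst 'i%C) (clim_real cy)).
rewrite (_ : _ \+ _ = eseries f); first exact: ecvgP.
by apply/funext => k; rewrite /= parts.
Qed.

(** Binomial convolution: the operation on coefficients that corresponds to multiplying exponential
    generating functions. *)
Definition econv (F : comNzRingType) (a b : nat -> F) k : F :=
  \sum_(j < k.+1) a (k - j)%N * b j *+ 'C(k, j).

Lemma econvE (F : fieldType) (a b : nat -> F) k : (forall n, n`!%:R != 0 :> F) ->
  (k`!%:R)^-1 * econv a b k =
  \sum_(j < k.+1) ((k - j)`!%:R^-1 * a (k - j)%N) * (j`!%:R^-1 * b j).
Proof.
move=> f0; rewrite mulr_sumr; apply: eq_bigr => j _.
have /(congr1 (fun n => n%:R : F)) := bin_fact (leq_ord j); rewrite !natrM => e.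
have C0 : 'C(k, j)%:R != 0 :> F.
  by apply: contra_neq (f0 k) => c; rewrite -e c mul0r.
by rewrite -[_ *+ _]mulr_natr -e; field; rewrite !f0 C0.
Qed.

(** The square of indices [i, j < n] is cut along the antidiagonal [i + j = n]. Having the defect as
    a single sum of products allows complex terms to be compared with real majorants. *)
Lemma sum_cauchy_defect (F : pzRingType) (a b : nat -> F) n :
  (\sum_(i < n) a i) * (\sum_(j < n) b j) -
    \sum_(k < n) \sum_(j < k.+1) a (k - j)%N * b j =
  \sum_(i < n) \sum_(j < n | (n <= i + j)%N) a i * b j.
Proof.
apply/eqP; rewrite subr_eq addrC; apply/eqP.
rewrite big_distrlr /=.
under eq_bigr => i _ do rewrite (bigID (fun j : 'I_n => (i + j < n)%N)) /=.
rewrite big_split /=; congr (_ + _); last first.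
  by apply: eq_bigr => i _; apply: eq_bigl => j; rewrite -leqNgt.
rewrite (exchange_big_dep xpredT) //= (eq_bigr (fun j : 'I_n =>
  \sum_(k < n | (j <= k)%N) a (k - j)%N * b j)); last first.
  (* For fixed [j], the shift [i = k - j] carries [j <= k < n] to [i + j < n]. *)
  move=> j _.
  rewrite -(big_mkord (fun i => (i + j < n)%N) (fun i => a i * b j)).
  rewrite -(big_mkord (fun k => (j <= k)%N) (fun k => a (k - j)%N * b j)).
  rewrite [RHS](big_cat_nat (n := j)) //=; last by rewrite ltnW.
  rewrite [X in _ = X + _]big1_seq ?add0r; last first.
    by move=> k; rewrite mem_index_iota => /andP[jk]; rewrite ltnNge jk.
  rewrite -[in RHS](add0n j) big_addn.
  rewrite [RHS](eq_bigl xpredT) => [|k]; last by rewrite leq_addl.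
  rewrite [RHS](eq_bigr (fun k => a k * b j)) => [|k _]; last by rewrite addnK.
  rewrite [LHS](big_cat_nat (n := (n - j)%N)) //= ?leq_subr // [X in _ + X]big1_seq ?addr0.
    rewrite big_seq_cond [RHS]big_seq_cond; apply: eq_bigl => k.
    by rewrite mem_index_iota /= addnC -ltn_subRL andbT andbb.
  move=> k; rewrite mem_index_iota => /andP[kj /andP[]].
  by rewrite leqNgt ltn_subRL addnC kj.
rewrite (exchange_big_dep xpredT) //=; apply: eq_bigr => k _.
rewrite [RHS](big_ord_widen n (fun j => a (k - j)%N * b j)) //.
Qed.

(** The Cauchy product defect is dominated termwise by the same defect for [K ^+ k] and [L ^+ k],
    which tends to 0 because [expR (K + L) = expR K * expR L]. *)
Lemma egfM f g (K L : R) :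
  (forall k, `|f k| <= (K ^+ k)%:C) -> (forall k, `|g k| <= (L ^+ k)%:C) ->
  egf (econv f g) = egf f * egf g.
Proof.
move=> fK gL; apply: egfE.
pose f' := fun k => (k`!%:R)^-1 * f k; pose g' := fun k => (k`!%:R)^-1 * g k.
pose K' := fun k => (k`!%:R)^-1 * K ^+ k; pose L' := fun k => (k`!%:R)^-1 * L ^+ k.
have fact0 (F : numFieldType) n : n`!%:R != 0 :> F by rewrite pnatr_eq0 -lt0n fact_gt0.
have f'K k : `|f' k| <= (K' k)%:C.
  by rewrite normrM normfV normr_nat rmorphM fmorphV rmorph_nat ler_wpM2l // invr_ge0.
have g'L k : `|g' k| <= (L' k)%:C.
  by rewrite normrM normfV normr_nat rmorphM fmorphV rmorph_nat ler_wpM2l // invr_ge0.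
pose defect n := eseries f n * eseries g n - eseries (econv f g) n.
suff h : clim defect 0.
  have := climB (climM (ecvg_le_expr fK) (ecvg_le_expr gL)) h.
  rewrite subr0 (_ : _ \- _ = eseries (econv f g)) //.
  by apply/funext => n; rewrite /defect /= opprB addrC subrK.
have sumE (F : numFieldType) (a b : nat -> F) n :
    series (fun k => (k`!%:R)^-1 * econv a b k) n =
    \sum_(k < n) \sum_(j < k.+1) ((k - j)`!%:R^-1 * a (k - j)%N) * (j`!%:R^-1 * b j).
  by rewrite /series /= big_mkord; apply: eq_bigr => k _; rewrite econvE.
pose e n := series K' n * series L' n -
  series (fun k => (k`!%:R)^-1 * econv (fun j => K ^+ j) (fun j => L ^+ j) k) n.
apply: (clim_squeeze (e := e)) => [n|].
  rewrite sub0r normrN /defect /eseries /e !sumE /series /= !big_mkord.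
  rewrite [X in `|X|](sum_cauchy_defect f' g' n) [X in X%:C](sum_cauchy_defect K' L' n).
  rewrite rmorph_sum (le_trans (ler_norm_sum _ _ _)) //; apply: ler_sum => i _.
  rewrite rmorph_sum (le_trans (ler_norm_sum _ _ _)) //; apply: ler_sum => j _.
  by rewrite normrM rmorphM ler_pM // (f'K, g'L).
rewrite -(subrr (expR (K + L))) {1}expRD; apply: cvgB.
  by apply: cvgM; exact: cvg_series_expR.
rewrite (_ : (fun k => _) = fun k => (k`!%:R)^-1 * (K + L) ^+ k).
  exact: cvg_series_expR.
by apply/funext => k; rewrite exprDn.
Qed.

End ExponentialGeneratingFunctions.

(** * Nonvanishing of an abstract partition function by cluster induction *)

Section ClusterInduction.
Import mathcomp.boot.fintype mathcomp.boot.finset.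
Variables (K : numFieldType) (J : finType) (adj : rel J) (S : {set J}) (D : nat).
Variables (x r : K) (Z : {set J} -> K) (W : {set J} -> {set J} -> K).
Hypotheses (x_ge0 : 0 <= x) (r_ge1 : 1 <= r).
Hypothesis rD_small : 1 + x * r ^+ D <= r * (1 - x * r ^+ D).
Hypothesis degD : forall Y, Y \in S -> (#|[set X in S | adj Y X]| <= D)%N.
Hypothesis W0 : forall B, W set0 B = Z B.
Hypothesis WU1 : forall (A B : {set J}) Y, Y \notin A -> Y \notin B ->
  W A (Y |: B) = W A B + W (Y |: A) B.
Hypothesis W_factor : forall A B : {set J}, A \subset S -> B \subset S -> [disjoint A & B] ->
  (forall X Y, X \in A -> Y \in B -> ~~ adj X Y) -> W A B = W A set0 * Z B.
Hypothesis W_le : forall A : {set J}, A \subset S -> `|W A set0| <= x ^+ #|A|.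
Hypothesis Z_set0 : Z set0 = 1.

Let border (A B : {set J}) := [set Y in B | [exists X in A, adj X Y]].

(* Neighbours of [A] are moved out of [B] one at a time, each either absorbed
   into [A] or discarded; every step costs at most a factor [r]. *)
Let cluster_bound (B : {set J}) : B \subset S ->
  (forall Y, Y \in B -> (1 - x * r ^+ D) * `|Z (B :\ Y)| <= `|Z B|) /\
  (forall A : {set J}, A \subset S -> [disjoint A & B] ->
     `|W A B| <= x ^+ #|A| * r ^+ #|border A B| * `|Z B|).
Proof.
have r_gt0 : 0 < r by rewrite (lt_le_trans ltr01).
have r_ge0 := ltW r_gt0.
move: {2}#|B| (leqnn #|B|) => n; elim: n B => [|n IHn] B Bn BS.
  have -> : B = set0 by apply/eqP; rewrite -cards_eq0 -leqn0.
  split=> [Y|A AS _]; first by rewrite inE.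
  rewrite Z_set0 normr1 mulr1 (le_trans (W_le AS)) // ler_peMr ?exprn_ge0 //.
  exact: exprn_ege1.
have IH Y (YB : Y \in B) : forall A : {set J}, A \subset S -> [disjoint A & B :\ Y] ->
    `|W A (B :\ Y)| <= x ^+ #|A| * r ^+ #|border A (B :\ Y)| * `|Z (B :\ Y)|.
  have [||//] := IHn (B :\ Y).
  - by move: Bn; rewrite (cardsD1 Y) YB.
  - by rewrite (subset_trans _ BS) ?subsetDl.
have border1 Y : Y \in B -> (#|border [set Y] (B :\ Y)| <= D)%N.
  move=> YB; apply: leq_trans (degD (subsetP BS _ YB)).
  apply/subset_leq_card/subsetP => X; rewrite !inE => /andP[/andP[_ XB]].
  by case/existsP => U; rewrite inE => /andP[/eqP ->]; rewrite (subsetP BS).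
(* Here [Z B = Z (B :\ Y) + W [set Y] (B :\ Y)], and the inductive bound on the second term costs at
   most [x r^D] times the norm of [Z (B :\ Y)]. *)
have ratio Y : Y \in B -> (1 - x * r ^+ D) * `|Z (B :\ Y)| <= `|Z B|.
  move=> YB; have := WU1 (A := set0) (B := B :\ Y) (Y := Y).
  rewrite !inE eqxx setD1K // setU0 !W0 => /(_ isT isT) ->.
  rewrite mulrBl mul1r -[W _ _]opprK (le_trans _ (lerB_dist _ _)) // normrN lerB //.
  have dY : [disjoint [set Y] & B :\ Y] by rewrite disjoints1 !inE eqxx.
  apply: le_trans (IH _ YB _ _ dY) _; first by rewrite sub1set (subsetP BS).
  by rewrite cards1 expr1 ler_wpM2r // ler_wpM2l // ler_weXn2l // border1.
split=> // A AS AB.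
(* If no neighbour of [A] is left in [B], factorization gives the bound; otherwise a neighbour [Y]
   is taken out of [B]. *)
have [b0|[Y]] := set_0Vmem (border A B).
  rewrite W_factor //.
    rewrite b0 cards0 expr0 mulr1 normrM ler_wpM2r //; exact: W_le.
  move=> X Y XA YB; apply: contraT; rewrite negbK => XY.
  have : Y \in border A B by rewrite inE YB; apply/existsP; exists X; rewrite XA.
  by rewrite b0 inE.
move=> Yb; have YB : Y \in B by move: Yb; rewrite inE => /andP[].
have YA : Y \notin A by apply: contraTN YB => /(disjointFr AB) ->.
have AB' : [disjoint A & B :\ Y] by rewrite (disjointWr _ AB) // subsetDl.
have YAB' : [disjoint Y |: A & B :\ Y].
  by rewrite disjoints_subset subUset sub1set -disjoints_subset AB' !inE eqxx.
have YAS : Y |: A \subset S by rewrite subUset AS sub1set (subsetP BS).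
have -> : border A B = Y |: border A (B :\ Y).
  apply/setP => X; rewrite !inE; have [->|//] := eqVneq X Y.
  by move: Yb; rewrite inE.
rewrite cardsU1 inE setD11 /= add1n.
rewrite -{1}(setD1K YB) WU1 ?setD11 //.
apply: le_trans (ler_normD _ _) _.
apply: le_trans (lerD (IH _ YB _ AS AB') (IH _ YB _ YAS YAB')) _.
rewrite cardsU1 YA add1n exprS.
set b := #|border A _|; set Z' := `|Z _|.
(* Absorbing [Y] adds at most its own [D] neighbours to the [b] remaining neighbours of [A]. *)
have bU : (#|border (Y |: A) (B :\ Y)| <= D + b)%N.
  apply: leq_trans (leq_add (border1 _ YB) (leqnn b)); rewrite -cardsUI.
  apply: leq_trans (leq_addr _ _); apply/subset_leq_card/subsetP => X.
  rewrite !inE => /andP[-> /existsP[U]]; rewrite !inE -andb_orr.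
  case/andP=> /orP[/eqP ->|UA] UX /=; apply/orP; [left|right]; apply/existsP.
    by exists Y; rewrite inE eqxx.
  by exists U; rewrite UA.
apply: (@le_trans _ _ (x ^+ #|A| * r ^+ b * (1 + x * r ^+ D) * Z')).
  rewrite mulrDr mulr1 mulrDl lerD2l ler_wpM2r ?normr_ge0 //.
  rewrite (_ : _ * (x * _) = x * x ^+ #|A| * r ^+ (D + b)).
    by rewrite ler_wpM2l ?mulr_ge0 ?exprn_ge0 // ler_weXn2l.
  by rewrite exprD; ring.
rewrite [leRHS](_ : _ = x ^+ #|A| * r ^+ b * (r * `|Z B|)); last by rewrite exprS; ring.
rewrite -mulrA ler_wpM2l ?mulr_ge0 ?exprn_ge0 //.
(* The hypothesis [rD_small] collects both branches into one factor [r], and [ratio] then trades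
   [Z'] for the norm of [Z B]. *)
apply: (@le_trans _ _ (r * (1 - x * r ^+ D) * Z')); first by rewrite ler_wpM2r ?normr_ge0.
by rewrite -mulrA ler_wpM2l // ratio.
Qed.

(** The ratio bound is a lower bound on [Z B] with a positive factor: [rD_small] gives
    [r (1 - x r^D) >= 1]. Removing elements one by one ends at [Z set0 = 1]. *)
Lemma cluster_partition_neq0 (B : {set J}) : B \subset S -> Z B != 0.
Proof.
have e_gt0 : 0 < 1 - x * r ^+ D.
  have r_gt0 : 0 < r by rewrite (lt_le_trans ltr01).
  rewrite -(pmulr_rgt0 _ r_gt0) (lt_le_trans _ rD_small) //.
  by rewrite ltr_wpDr // mulr_ge0 // exprn_ge0 // ltW.
move: {2}#|B| (erefl #|B|) => n; elim: n B => [|n IHn] B Bn BS.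
  have /eqP -> : B == set0 by rewrite -cards_eq0 Bn.
  by rewrite Z_set0 oner_eq0.
have [B0|[Y YB]] := set_0Vmem B; first by rewrite B0 cards0 in Bn.
have ZY : Z (B :\ Y) != 0.
  apply: IHn; last by rewrite (subset_trans _ BS) ?subsetDl.
  by move: Bn; rewrite (cardsD1 Y) YB => -[].
rewrite -normr_gt0 (lt_le_trans _ ((cluster_bound BS).1 _ YB)) //.
by rewrite mulr_gt0 // normr_gt0.
Qed.

End ClusterInduction.

(** * Sums over words with compulsory letters *)

Section Words.
Import mathcomp.boot.fintype mathcomp.boot.finset.
Variable J : finType.
Implicit Types A B : {set J}.

(** Letters of [A] are compulsory, those of [B] optional: up to the factor [1/m!], this is the
    degree [m] part of [W(A; B)]. *)
Definition wsum (M : nmodType) m (F : {ffun 'I_m -> J} -> M) A B : M :=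
  \sum_(w in ffun_on (mem (A :|: B)) | A \subset codom w) F w.

(** Words over the alphabet enlarged by [Y] are sorted by whether [Y] occurs in them. *)
Lemma wsumU1 (M : nmodType) m (F : {ffun 'I_m -> J} -> M) A B Y :
  Y \notin A -> Y \notin B ->
  wsum F A (Y |: B) = wsum F A B + wsum F (Y |: A) B.
Proof.
move=> YA YB; rewrite /wsum (bigID (fun w : {ffun 'I_m -> J} => Y \in codom w)) /=.
rewrite addrC; congr (_ + _); apply: eq_bigl => w.
  rewrite andbAC; congr (_ && _); apply/andP/ffun_onP.
    move=> [/ffun_onP wAB Yw] i; have := wAB i; rewrite !inE.
    by case: eqP => [wY|//]; rewrite -wY codom_f in Yw.
  move=> wAB; split.
    by apply/ffun_onP => i; move: (wAB i); rewrite !inE => /orP[] ->; rewrite ?orbT.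
  by apply/negP => /codomP[i Yi]; have := wAB i; rewrite -Yi inE (negPf YA) (negPf YB).
rewrite setUCA setUA -andbA; congr (_ && _); apply/andP/subsetP.
  by move=> [/subsetP Aw Yw] X; rewrite !inE => /predU1P[->|/Aw].
move=> YAw; split; last by apply: YAw; rewrite setU11.
by apply/subsetP => X XA; apply: YAw; rewrite setU1r.
Qed.

Lemma wsum0 (M : nmodType) m (F : {ffun 'I_m -> J} -> M) B :
  wsum F set0 B = \sum_(w in ffun_on (mem B)) F w.
Proof.
apply: eq_bigl => w; rewrite set0U andb_idr // => _.
by apply/subsetP => X; rewrite inE.
Qed.

(** Words keep the order of their letters, so the expansion holds without commutativity. *)
Lemma exp_sum_wsum (Q : pzRingType) (G : J -> Q) B m :
  (\sum_(X in B) G X) ^+ m = wsum (fun w => \prod_(i < m) G (w i)) set0 B.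
Proof.
rewrite wsum0 -(bigA_distr_big (mem B) (fun _ : 'I_m => G)).
by rewrite prodr_const card_ord.
Qed.

Lemma wsum_le_wsum0 (K : numDomainType) m (F : {ffun 'I_m -> J} -> K) A B :
  (forall w, 0 <= F w) -> wsum F A B <= wsum F set0 (A :|: B).
Proof.
move=> F0; rewrite wsum0 /wsum big_mkcondr; apply: ler_sum => w _.
by case: ifP.
Qed.

End Words.

(** * Amplitudes as generating functions of moments, and their factorization *)

Section Amplitudes.
Import mathcomp.boot.fintype mathcomp.boot.finset.
Variables (R : realType) (n : nat).
Implicit Types (Phi : 'cV[R[i]]_n) (P Q : 'M[R[i]]_n).

Definition expect Phi P : R[i] := inner Phi (P *m Phi).

Lemma expect_sum Phi (I : Type) (s : seq I) (p : pred I) (F : I -> 'M[R[i]]_n) :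
  expect Phi (\sum_(i <- s | p i) F i) = \sum_(i <- s | p i) expect Phi (F i).
Proof. by rewrite /expect /inner mulmx_suml mulmx_sumr summxE. Qed.

Lemma expectZ Phi (a : R[i]) P : expect Phi (a *: P) = a * expect Phi P.
Proof. by rewrite /expect /inner -scalemxAl -scalemxAr mxE. Qed.

Lemma expectMn Phi P m : expect Phi (P *+ m) = expect Phi P *+ m.
Proof. by rewrite -scaler_nat expectZ mulr_natl. Qed.

Variables (J : finType) (adj : rel J) (S : {set J}) (D : nat) (t : R).
Variables (G : J -> 'M[R[i]]_n) (Phi : 'cV[R[i]]_n).
Hypothesis t_ge0 : 0 <= t.
Hypothesis Phi1 : inner Phi Phi = 1.
Hypothesis G_le : forall m (w : 'I_m -> J),
  `|expect Phi (\prod_(i < m) G (w i))| <= (t ^+ m)%:C.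
Hypothesis G_comm : forall A B : {set J}, A \subset S -> B \subset S ->
  [disjoint A & B] -> (forall X Y, X \in A -> Y \in B -> ~~ adj X Y) ->
  GRing.comm (\sum_(X in A) G X) (\sum_(X in B) G X).
Hypothesis G_indep : forall A B : {set J}, A \subset S -> B \subset S ->
  [disjoint A & B] -> (forall X Y, X \in A -> Y \in B -> ~~ adj X Y) ->
  forall j k, expect Phi ((\sum_(X in A) G X) ^+ j * (\sum_(X in B) G X) ^+ k) =
    expect Phi ((\sum_(X in A) G X) ^+ j) * expect Phi ((\sum_(X in B) G X) ^+ k).

Let moment (B : {set J}) m := expect Phi ((\sum_(X in B) G X) ^+ m).
Let Z B := egf (moment B).
Let coeff A B m := wsum (fun w => expect Phi (\prod_(i < m) G (w i))) A B.
Let W A B := egf (coeff A B).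

Let coeff0 B : coeff set0 B = moment B.
Proof.
by apply/funext => m; rewrite /moment exp_sum_wsum /wsum expect_sum.
Qed.

Let majorant A B m : R := wsum (fun _ : {ffun 'I_m -> J} => t ^+ m) A B.

Let coeff_le A B m : `|coeff A B m| <= (majorant A B m)%:C.
Proof.
rewrite /coeff /majorant /wsum rmorph_sum (le_trans (ler_norm_sum _ _ _)) //.
by apply: ler_sum => w _; exact: G_le.
Qed.

Let majorant0 (B : {set J}) m : majorant set0 B m = (#|B|%:R * t) ^+ m.
Proof.
rewrite /majorant wsum0 mulr_natl -sumr_const.
under eq_bigr => w _ do rewrite -[X in t ^+ X]card_ord -prodr_const.
by rewrite -(bigA_distr_big (mem B) (fun (_ : 'I_m) _ => t)) prodr_const card_ord.
Qed.

Let coeff_le_exp (A B : {set J}) m : `|coeff A B m| <= ((#|A :|: B|%:R * t) ^+ m)%:C.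
Proof.
rewrite (le_trans (coeff_le _ _ _)) // lecR -majorant0.
by apply: wsum_le_wsum0 => w; rewrite exprn_ge0.
Qed.

Let moment_le (B : {set J}) m : `|moment B m| <= ((#|B|%:R * t) ^+ m)%:C.
Proof. by rewrite -coeff0 -{2}[B]set0U. Qed.

Lemma expect_exp_sum_le (B : {set J}) m :
  `|expect Phi ((\sum_(X in B) G X) ^+ m)| <= ((#|B|%:R * t) ^+ m)%:C.
Proof. exact: moment_le. Qed.

(** In the weighted count of words, an optional letter contributes [expR t] and a compulsory one
    [expR t - 1], since it has to occur. The induction makes one compulsory letter optional and
    subtracts the words that avoid it. *)
Let majorant_cvg (A B : {set J}) : [disjoint A & B] ->
  (series (fun k => (k`!%:R)^-1 * majorant A B k) @ \oo -->
    (expR t - 1) ^+ #|A| * expR (#|B|%:R * t))%classic.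
Proof.
move: {2}#|A| (erefl #|A|) => m; elim: m A B => [|m IHm] A B Am AB.
  have /eqP -> : A == set0 by rewrite -cards_eq0 Am.
  rewrite cards0 expr0 mul1r (_ : (fun k => _) = fun k => (k`!%:R)^-1 * (#|B|%:R * t) ^+ k).
    exact: cvg_series_expR.
  by apply/funext => k; rewrite majorant0.
have [A0|[Y YA]] := set_0Vmem A; first by rewrite A0 cards0 in Am.
have YB : Y \notin B by rewrite (disjointFr AB YA).
have A'm : #|A :\ Y| = m by move: Am; rewrite (cardsD1 Y) YA => -[].
have A'B : [disjoint A :\ Y & B] by rewrite (disjointWl _ AB) // subsetDl.
have A'YB : [disjoint A :\ Y & Y |: B].
  by rewrite disjoint_sym disjoints_subset subUset sub1set !inE eqxx
    -disjoints_subset disjoint_sym.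
have -> : series (fun k => (k`!%:R)^-1 * majorant A B k) =
    series (fun k => (k`!%:R)^-1 * majorant (A :\ Y) (Y |: B) k) \-
    series (fun k => (k`!%:R)^-1 * majorant (A :\ Y) B k).
  apply/funext => k; rewrite /series /= -sumrB; apply: eq_bigr => j _.
  by rewrite -mulrBr /majorant wsumU1 ?setD11 // setD1K // [X in X - _]addrC addrK.
have -> : (expR t - 1) ^+ #|A| * expR (#|B|%:R * t) =
    (expR t - 1) ^+ #|A :\ Y| * expR (#|Y |: B|%:R * t) -
    (expR t - 1) ^+ #|A :\ Y| * expR (#|B|%:R * t).
  by rewrite A'm Am cardsU1 YB add1n -natr1 mulrDl mul1r expRD exprS; ring.
exact: cvgB (IHm _ _ A'm A'YB) (IHm _ _ A'm A'B).
Qed.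

(** The two partial sums commute, so the binomial theorem applies; independence then turns the
    moments of the union into a binomial convolution. *)
Let Z_mul (A B : {set J}) : A \subset S -> B \subset S -> [disjoint A & B] ->
  (forall X Y, X \in A -> Y \in B -> ~~ adj X Y) -> Z (A :|: B) = Z A * Z B.
Proof.
move=> AS BS AB nAB; rewrite /Z -(egfM (moment_le A) (moment_le B)).
congr egf; apply/funext => m; rewrite /moment /econv.
rewrite (eq_bigl [predU A & B]) => [|X]; last by rewrite !inE.
rewrite bigU //= exprDn_comm; last exact: G_comm.
rewrite expect_sum; apply: eq_bigr => j _.
by rewrite expectMn G_indep.
Qed.

Let WU1 (A B : {set J}) Y : Y \notin A -> Y \notin B ->
  W A (Y |: B) = W A B + W (Y |: A) B.
Proof.
move=> YA YB; apply/eqP; rewrite addrC -subr_eq; apply/eqP.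
rewrite /W -(egfB (ecvg_le_expr (coeff_le_exp _ _)) (ecvg_le_expr (coeff_le_exp _ _))).2.
congr egf; apply/funext => m /=.
by rewrite /coeff wsumU1 // [X in X - _]addrC addrK.
Qed.

Let W0 B : W set0 B = Z B.
Proof. by rewrite /W coeff0. Qed.

(** The set [C] is there for the induction on [A]: by inclusion and exclusion a compulsory letter is
    either moved to [C] or dropped, until [Z_mul] applies. The case [C = set0] is the factorization
    that the cluster induction asks for. *)
Let W_mul (A C B : {set J}) : A :|: C \subset S -> B \subset S -> [disjoint A & C] ->
  [disjoint A :|: C & B] -> (forall X Y, X \in A :|: C -> Y \in B -> ~~ adj X Y) ->
  W A (C :|: B) = W A C * Z B.
Proof.
move: {2}#|A| (erefl #|A|) => m; elim: m A C => [|m IHm] A C Am.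
  have /eqP -> : A == set0 by rewrite -cards_eq0 Am.
  by rewrite set0U !W0 => CS BS _ CB nCB; exact: Z_mul.
have [A0|[Y YA]] := set_0Vmem A; first by rewrite A0 cards0 in Am.
move=> ACS BS AC ACB nACB.
have YC : Y \notin C by rewrite (disjointFr AC YA).
have YB : Y \notin B by rewrite (disjointFr ACB) // inE YA.
have A'm : #|A :\ Y| = m by move: Am; rewrite (cardsD1 Y) YA => -[].
have sub : (A :\ Y) :|: C \subset A :|: C by rewrite setSU // subsetDl.
have eqU : (A :\ Y) :|: (Y |: C) = A :|: C by rewrite setUCA setUA setD1K.
have -> : W A (C :|: B) = W (A :\ Y) (Y |: C :|: B) - W (A :\ Y) (C :|: B).
  rewrite -setUA WU1 ?setD11 ?inE ?negb_or ?YC ?YB //.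
  by rewrite setD1K // [X in X - _]addrC addrK.
have -> : W A C = W (A :\ Y) (Y |: C) - W (A :\ Y) C.
  by rewrite WU1 ?setD11 // setD1K // [X in X - _]addrC addrK.
have A'C : [disjoint A :\ Y & C] by rewrite (disjointWl _ AC) // subsetDl.
rewrite mulrBl; congr (_ - _); apply: IHm => //.
- by rewrite eqU.
- by rewrite disjoint_sym disjoints_subset subUset sub1set !inE eqxx
    -disjoints_subset disjoint_sym.
- by rewrite eqU.
- by rewrite eqU.
- exact: fintype.subset_trans ACS.
- exact: disjointWl ACB.
- by move=> X X' /(subsetP sub); exact: nACB.
Qed.

Let Z_set0 : Z set0 = 1.
Proof.
apply: egfE; rewrite -[1](rmorph1 (real_complex R)) /= -(expR0 R).
suff -> : eseries (moment set0) = fun m => (series (fun k => (k`!%:R)^-1 * 0 ^+ k) m)%:C.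
  exact: clim_real (@cvg_series_expR _ 0).
apply/funext => m; rewrite /eseries /series /= rmorph_sum /=; apply: eq_bigr => k _.
rewrite rmorphM fmorphV rmorph_nat /moment big_set0; congr (_ * _).
(* Only degree 0 survives, where the empty sum has power [0 ^+ 0 = 1]. *)
case: k => [|k]; first by rewrite !expr0 /expect mul1mx.
by rewrite !expr0n /= /expect mul0mx /inner mulmx0 mxE.
Qed.

(** The cluster induction is run with weight [x = expR t - 1], the contribution of one compulsory
    letter. *)
Lemma amplitude_neq0 (r : R) :
  1 <= r -> 1 + (expR t - 1) * r ^+ D <= r * (1 - (expR t - 1) * r ^+ D) ->
  (forall Y, Y \in S -> (#|[set X in S | adj Y X]| <= D)%N) ->
  egf (fun m => expect Phi ((\sum_(X in S) G X) ^+ m)) != 0.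
Proof.
move=> r1 rD degD.
apply: (@cluster_partition_neq0 _ J adj S D (expR t - 1)%:C r%:C Z W) => //.
- by rewrite ler0c subr_ge0 -(expR0 R) ler_expR.
- by rewrite -[1](rmorph1 (real_complex R)) lecR.
- rewrite -[1](rmorph1 (real_complex R)) -rmorphXn -rmorphM -rmorphB -rmorphM -rmorphD.
  by rewrite lecR.
- move=> A B AS BS AB nAB; rewrite -[X in W A X]set0U W_mul ?setU0 //.
  by rewrite disjoint_sym disjoints_subset sub0set.
- move=> A AS; rewrite -rmorphXn.
  apply: egf_norm_le (ecvg_le_expr (coeff_le_exp _ _)) (coeff_le _ _) _.
  have := @majorant_cvg A set0; rewrite cards0 mul0r expR0 mulr1; apply.
  by rewrite disjoint_sym disjoints_subset sub0set.
Qed.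

End Amplitudes.

(** * Inner product, vector norm and operator norm *)

Section InnerProduct.
Variables (R : realType) (n : nat).
Implicit Types (u v w : 'cV[R[i]]_n) (a : R[i]).

Lemma innerE u v : inner u v = \sum_i (u i ord0)^* * v i ord0.
Proof. by rewrite /inner mxE; apply: eq_bigr => i _; rewrite !mxE. Qed.

Lemma innerC u v : inner u v = (inner v u)^*.
Proof.
rewrite !innerE rmorph_sum; apply: eq_bigr => i _.
by rewrite rmorphM /= conjCK mulrC.
Qed.

Lemma innerBr u v w : inner u (v - w) = inner u v - inner u w.
Proof. by rewrite !innerE -sumrB; apply: eq_bigr => i _; rewrite !mxE mulrBr. Qed.

Lemma innerZr u a v : inner u (a *: v) = a * inner u v.
Proof. by rewrite !innerE mulr_sumr; apply: eq_bigr => i _; rewrite mxE mulrCA. Qed.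

Lemma inner_ge0 u : 0 <= inner u u.
Proof. by rewrite innerE sumr_ge0 // => i _; rewrite mulrC mul_conjC_ge0. Qed.

Lemma innervv u : inner u u = (vnorm u ^+ 2)%:C.
Proof.
have u0 := inner_ge0 u; have ur := RRe_real (ger0_real u0).
by rewrite /vnorm sqr_sqrtr ?ur // -ler0c ur.
Qed.

Lemma vnorm_ge0 u : 0 <= vnorm u.
Proof. exact: sqrtr_ge0. Qed.

Lemma vnormZ a u : (vnorm (a *: u))%:C = `|a| * (vnorm u)%:C.
Proof.
apply/eqP; rewrite -(@eqrXn2 _ 2) ?mulr_ge0 ?normr_ge0 ?ler0c ?vnorm_ge0 //; apply/eqP.
rewrite exprMn normCK -!rmorphXn /= -!innervv innerZr innerC innerZr rmorphM /=.
by rewrite -innerC mulrA.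
Qed.

Lemma vnorm_eq0 u : vnorm u = 0 -> u = 0.
Proof.
move=> u0; have := innervv u; rewrite u0 expr0n /= => /eqP.
rewrite innerE psumr_eq0 => [/allP h|i _]; last by rewrite mulrC mul_conjC_ge0.
apply/matrixP => i j; rewrite mxE (ord1 j).
have /implyP/(_ isT) := h i (mem_index_enum i).
by rewrite mulrC mul_conjC_eq0 => /eqP.
Qed.

(** This is the nonnegativity of the squared length of [v - c *: u], the component of [v] orthogonal
    to [u]. *)
Lemma CauchySchwarz_unit u v : vnorm u = 1 -> `|inner u v| <= (vnorm v)%:C.
Proof.
move=> u1; have uu : inner u u = 1 by rewrite innervv u1 expr1n.
rewrite -(@ler_pXn2r _ 2) ?nnegrE ?normr_ge0 ?ler0c ?vnorm_ge0 //.
rewrite normCK -rmorphXn /= -innervv -subr_ge0.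
set c := inner u v; have := inner_ge0 (v - c *: u).
rewrite innerBr innerZr [inner _ v]innerC [inner _ u]innerC !innerBr !innerZr.
rewrite uu mulr1 -/c subrr conjC0 mulr0 subr0 rmorphB rmorphM /= -!innerC -/c.
by rewrite (mulrC c).
Qed.

Lemma opnorm1_le (A : 'M[R[i]]_n) u : opnorm A = 1 -> vnorm (A *m u) <= vnorm u.
Proof.
move=> A1.
have unit_le v : vnorm v <= 1 -> vnorm (A *m v) <= 1.
  move=> v1; rewrite -A1; apply: sup_upper_bound; last by exists v.
  (* [sup] is 0 on a set without a supremum, so the value 1 rules that case out. *)
  apply: contrapT => /sup_out; rewrite -/(opnorm A) A1 => /eqP.
  by rewrite oner_eq0.
have [u0|u_neq0] := eqVneq (vnorm u) 0.
  by rewrite (vnorm_eq0 u0) mulmx0.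
have u_gt0 : 0 < vnorm u by rewrite lt_neqAle eq_sym u_neq0 vnorm_ge0.
pose c : R[i] := ((vnorm u)^-1)%:C.
have c_norm : `|c| = c by rewrite ger0_norm // ler0c invr_ge0 ltW.
have scale v : vnorm (c *: v) = (vnorm u)^-1 * vnorm v.
  by apply: complexI; rewrite vnormZ c_norm rmorphM.
have := unit_le (c *: u); rewrite -scalemxAr !scale mulVf // lexx => /(_ isT).
by rewrite ler_pdivrMl // mulr1.
Qed.

End InnerProduct.

(** * Localized operators and independence in product states *)

Section Locality.
Import mathcomp.boot.fintype mathcomp.boot.finset.
Variables (R : realType) (d : nat) (V : finType).
Implicit Types (X Y : {set V}) (P Q : oper R d V) (s t u z : conf d V).

Definition ker P s t : R[i] := P (enum_rank s) (enum_rank t).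

Lemma sum_conf (M : nmodType) (F : 'I_#|conf d V| -> M) :
  \sum_i F i = \sum_s F (enum_rank s).
Proof. by rewrite (reindex _ (onW_bij _ (enum_rank_bij _))). Qed.

Lemma ker_inj P Q : (forall s t, ker P s t = ker Q s t) -> P = Q.
Proof.
move=> PQ; apply/matrixP => i j.
by have := PQ (enum_val i) (enum_val j); rewrite /ker !enum_valK.
Qed.

Lemma kerM P Q s u : ker (P *m Q) s u = \sum_t ker P s t * ker Q t u.
Proof. by rewrite /ker mxE sum_conf. Qed.

Lemma ker1 s u : ker (1%:M : oper R d V) s u = (s == u)%:R.
Proof. by rewrite /ker mxE (inj_eq enum_rank_inj). Qed.

Definition merge X s t : conf d V := [ffun v => if v \in X then s v else t v].

Definition eq_off X s t := [forall v, (v \notin X) ==> (s v == t v)].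

Lemma eq_offP X s t :
  reflect (forall v, v \notin X -> s v = t v) (eq_off X s t).
Proof.
apply: (iffP forallP) => st v; first by move=> vX; have /implyP/(_ vX)/eqP := st v.
by apply/implyP => vX; rewrite st.
Qed.

Lemma merge_mergel X Y s t z : X \subset Y -> merge X (merge Y s t) z = merge X s z.
Proof.
move=> XY; apply/ffunP => v; rewrite !ffunE; case: ifP => // /(subsetP XY).
by move=> ->.
Qed.

Lemma merge_merger X s t z : merge X z (merge X s t) = merge X z t.
Proof. by apply/ffunP => v; rewrite !ffunE; case: (v \in X). Qed.

Lemma mergeC X s t : merge (~: X) s t = merge X t s.
Proof. by apply/ffunP => v; rewrite !ffunE inE if_neg. Qed.

Lemma merge_id X s t : eq_off X s t -> merge X s t = s.
Proof.
move=> /eq_offP st; apply/ffunP => v; rewrite !ffunE.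
by case: ifPn => // /st.
Qed.

Lemma eq_off_merge X s t z : eq_off X (merge X s z) (merge X t z).
Proof. by apply/eq_offP => v /negPf vX; rewrite !ffunE vX. Qed.

Lemma eq_off_sym X s t : eq_off X s t = eq_off X t s.
Proof. by apply/eq_offP/eq_offP => st v /st ->. Qed.

Lemma eq_off_mergel X s t z : eq_off X (merge X s z) t = eq_off X z t.
Proof.
by apply/eq_offP/eq_offP => st v vX; move: (st v vX); rewrite ffunE (negPf vX).
Qed.

Lemma eq_off_trans X : transitive (eq_off X).
Proof.
by move=> t s u /eq_offP st /eq_offP tu; apply/eq_offP => v vX; rewrite st ?tu.
Qed.

(** A form of [acts_on] that speaks of configurations of [V] only: matrix elements vanish unless
    both configurations agree off [X], and their common values there do not matter. The arbitrary
    background [z] replaces those values. *)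
Definition localized X P := forall s u z,
  ker P s u = ker P (merge X s z) (merge X u z) *+ eq_off X s u.

Lemma acts_on_localized X P : acts_on X P -> localized X P.
Proof.
move=> [B ->] s u z; rewrite /ker !mxE !enum_rankK -/(eq_off X s u).
rewrite -/(eq_off X _ _) eq_off_merge mulr1n.
have rm w : Defs.restrict X (merge X w z) = Defs.restrict X w.
  by apply/ffunP => v; rewrite !ffunE (valP v).
by rewrite !rm.
Qed.

Lemma localized0 X : localized X 0.
Proof. by move=> s u z; rewrite /ker !mxE mul0rn. Qed.

Lemma localizedD X P Q : localized X P -> localized X Q -> localized X (P + Q).
Proof.
move=> lP lQ s u z; have := congr2 +%R (lP s u z) (lQ s u z).
by rewrite -mulrnDl /ker !mxE.
Qed.

Lemma localizedZ X a P : localized X P -> localized X (a *: P).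
Proof.
by move=> lP s u z; have := lP s u z; rewrite /ker !mxE => ->; rewrite mulrnAr.
Qed.

Lemma localized1 X : localized X 1%:M.
Proof.
move=> s u z; rewrite !ker1 -mulrnA mulnb; congr (_ %:R); congr nat_of_bool.
apply/eqP/andP => [->|[/eqP e /eq_offP o]].
  by split; [exact: eqxx | apply/eq_offP].
apply/ffunP => v; have [vX|/o//] := boolP (v \in X).
by move/ffunP/(_ v): e; rewrite !ffunE vX.
Qed.

Lemma localizedW X Y P : X \subset Y -> localized X P -> localized Y P.
Proof.
move=> XY lP s u z; rewrite (lP s u z) (lP (merge Y s z) _ z) -mulrnA mulnb.
rewrite !merge_mergel //; congr (_ *+ _); congr nat_of_bool.
apply/eq_offP/andP => [su|[/eq_offP h1 /eq_offP h2] v vX].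
  split; apply/eq_offP => v vX.
    by rewrite !ffunE; case: ifP => // _; exact: su.
  by apply: su; apply: contra vX; exact: (subsetP XY).
have := h1 v vX; rewrite !ffunE; case: ifPn => // vY _; exact: h2.
Qed.

(** Only intermediate configurations that agree with [s] off [X] contribute, and they correspond
    bijectively to those that agree with [z] off [X]. *)
Lemma localizedM X P Q : localized X P -> localized X Q -> localized X (P *m Q).
Proof.
move=> lP lQ s u z; rewrite !kerM.
have [su|nsu] := boolP (eq_off X s u); last first.
  rewrite mulr0n big1 // => t _; rewrite (lP s t z) (lQ t u z).
  have [st|_] := boolP (eq_off X s t); last by rewrite mulr0n mul0r.
  have [tu|_] := boolP (eq_off X t u); last by rewrite mulr0n mulr0.
  by rewrite (eq_off_trans st tu) in nsu.
rewrite mulr1n (bigID (eq_off X s)) /= [X in _ + X]big1 ?addr0; last first.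
  by move=> t /negPf st; rewrite (lP s t z) st mulr0n mul0r.
rewrite (reindex_onto (fun t => merge X t s) (fun t => merge X t z)) /=; last first.
  move=> t st; rewrite merge_mergel // merge_id // eq_off_sym //.
rewrite [RHS](bigID (eq_off X z)) /= [X in _ + X]big1 ?addr0; last first.
  move=> t /negPf zt; rewrite (lP _ t z) eq_off_mergel zt mulr0n mul0r //.
apply: eq_big => t.
  rewrite eq_off_sym eq_off_mergel (introT (eq_offP _ _ _)) //=.
  rewrite merge_mergel //; apply/eqP/idP => [<-|zt].
    by rewrite eq_off_sym eq_off_mergel; apply/eq_offP.
  by rewrite merge_id // eq_off_sym.
rewrite merge_mergel // => /andP[_ /eqP tz].
rewrite (lP s _ z) (lQ _ u z) !merge_mergel // tz eq_off_mergel su.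
by rewrite eq_off_sym eq_off_mergel (introT (eq_offP _ _ _)).
Qed.

Lemma localized_sum X (I : finType) (p : pred I) (F : I -> oper R d V) :
  (forall i, p i -> localized X (F i)) -> localized X (\sum_(i | p i) F i).
Proof.
move=> lF; apply: (big_ind (localized X)) => //; first exact: localized0.
by move=> P Q; exact: localizedD.
Qed.

Lemma localizedX X P k : localized X P -> localized X (P ^+ k).
Proof.
move=> lP; elim: k => [|k IHk]; first by rewrite expr0; exact: localized1.
by rewrite exprS; exact: localizedM.
Qed.

(** An intermediate configuration must agree with [s] off [X] and with [u] on [X], so the sum has
    the single term [merge X u s]. *)
Lemma ker_localizedM X P Q s u z z' : localized X P -> localized (~: X) Q ->
  ker (P *m Q) s u =
  ker P (merge X s z) (merge X u z) * ker Q (merge X z' s) (merge X z' u).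
Proof.
move=> lP lQ; rewrite kerM (bigD1 (merge X u s)) //= big1 ?addr0.
  rewrite (lP _ _ z) (lQ _ _ z') merge_mergel // !mergeC merge_merger.
  rewrite (introT (eq_offP _ _ _)) ?(introT (eq_offP _ _ _)) //.
    by move=> v; rewrite !inE negbK ffunE => ->.
  by move=> v /negPf vX; rewrite ffunE vX.
move=> t; apply: contraNeq => PQ; apply/eqP/ffunP => v; rewrite ffunE.
have [vX|vX] := boolP (v \in X).
  have : eq_off (~: X) t u.
    by apply: contraNT PQ => /negPf h; rewrite (lQ _ _ z) h mulr0n mulr0.
  by move/eq_offP; apply; rewrite inE vX.
have : eq_off X s t.
  by apply: contraNT PQ => /negPf h; rewrite (lP _ _ z) h mulr0n mul0r.
by move/eq_offP => ->.
Qed.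

Lemma localized_comm X P Q : localized X P -> localized (~: X) Q ->
  P *m Q = Q *m P.
Proof.
move=> lP lQ; apply: ker_inj => s u.
have lP' : localized (~: ~: X) P by rewrite setCK.
by rewrite (ker_localizedM s u s s lP lQ) (ker_localizedM s u s s lQ lP') !mergeC mulrC.
Qed.

Variable Phi : ket R d V.

(** Summing over pairs of configurations puts the product into a doubled system, where spins can be
    exchanged between the copies. *)
Lemma expectM P Q : expect Phi P * expect Phi Q =
  \sum_(p : conf d V * conf d V) \sum_(q : conf d V * conf d V)
    ((Phi (enum_rank p.1) ord0)^* * (Phi (enum_rank p.2) ord0)^*) *
    (ker P p.1 q.1 * ker Q p.2 q.2) *
    (Phi (enum_rank q.1) ord0 * Phi (enum_rank q.2) ord0).
Proof.
have expectE T : expect Phi T = \sum_s \sum_u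
    (Phi (enum_rank s) ord0)^* * ker T s u * Phi (enum_rank u) ord0.
  rewrite /expect innerE sum_conf; apply: eq_bigr => s _.
  by rewrite mxE sum_conf mulr_sumr; apply: eq_bigr => u _; rewrite mulrA.
rewrite !expectE big_distrlr pair_big /=; apply: eq_bigr => -[s s'] _ /=.
rewrite big_distrlr pair_big /=; apply: eq_bigr => -[u u'] _ /=.
by ring.
Qed.

(* Two independent copies of the system: exchanging the spins outside [X] of
   the two copies fixes [Phi (x) Phi] and turns [P (x) Q] into [P Q (x) 1]. *)
Lemma product_state_expectM X P Q : product_state Phi ->
  localized X P -> localized (~: X) Q ->
  expect Phi (P *m Q) = expect Phi P * expect Phi Q.
Proof.
move=> [Phi1 [phi Phi_phi]] lP lQ.
(* The factor [expect Phi 1%:M = 1] supplies the second copy. *)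
have -> : expect Phi (P *m Q) = expect Phi (P *m Q) * expect Phi 1%:M.
  by rewrite {3}/expect mul1mx innervv Phi1 expr1n mulr1.
pose swap (p : conf d V * conf d V) := (merge X p.1 p.2, merge X p.2 p.1).
have swapK : involutive swap.
  move=> [s s']; rewrite /swap /=.
  by congr (_, _); apply/ffunP => v; rewrite !ffunE; case: (v \in X).
(* The exchange only permutes the one-spin factors of the two copies; this is where the product form
   enters. *)
have Phi_swap s s' : Phi (enum_rank (merge X s s')) ord0 *
    Phi (enum_rank (merge X s' s)) ord0 =
    Phi (enum_rank s) ord0 * Phi (enum_rank s') ord0.
  rewrite !Phi_phi -!big_split; apply: eq_bigr => v _ /=.
  by rewrite !ffunE; case: ifP => // _; rewrite mulrC.
rewrite !expectM (reindex_inj (inv_inj swapK)); apply: eq_bigr => -[s s'] _.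
rewrite (reindex_inj (inv_inj swapK)); apply: eq_bigr => -[u u'] _ /=.
rewrite Phi_swap -!rmorphM Phi_swap; congr (_ * _ * _).
rewrite (ker_localizedM _ _ s s lP lQ) !merge_mergel // !merge_merger ker1 mulr_natr.
rewrite (lP s u s) (lQ s' u' s) !mergeC mulrnAl mulrnAr.
rewrite -mulrnA mulnb; congr (_ *+ _); congr nat_of_bool.
(* Equality of the exchanged second copies means that [s] and [u] agree off [X] while [s'] and [u']
   agree on [X]. *)
apply/eqP/andP => [/ffunP e|[/eq_offP h2 /eq_offP h1]].
  split; apply/eq_offP => v; have := e v; rewrite !ffunE ?inE ?negbK.
    by move=> + vX; rewrite vX.
  by case: ifP.
apply/ffunP => v; rewrite !ffunE; case: ifPn => vX; last exact: h1.
by apply: h2; rewrite inE vX.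
Qed.

End Locality.

(** * Expectation of the matrix exponential as a generating function *)

Section MatrixExponential.
Local Open Scope classical_set_scope.
Local Open Scope ring_scope.
Variables (R : realType) (n : nat).
Implicit Types (M : 'M[R[i]]_n) (Phi : 'cV[R[i]]_n).

Lemma expmxZn (a : R[i]) M k : (a *: M) ^+ k = a ^+ k *: M ^+ k.
Proof.
elim: k => [|k IHk]; first by rewrite !expr0 scale1r.
by rewrite !exprS IHk -!mulmxE -scalemxAl -scalemxAr scalerA.
Qed.

Lemma expr_entry_le M : exists K : R,
  forall k i j, `|(M ^+ k) i j| <= (K ^+ k)%:C.
Proof.
(* This sum dominates every row sum, which makes the entries of the powers grow at most
   geometrically. *)
pose c := \sum_i \sum_j `|M i j|.
have c_ge0 : 0 <= c by rewrite sumr_ge0 // => i _; rewrite sumr_ge0.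
have cE : (complex.Re c)%:C = c by rewrite RRe_real // ger0_real.
exists (complex.Re c) => k; rewrite rmorphXn /= cE.
elim: k => [|k IHk] i j.
  by rewrite !expr0 mxE; case: (_ == _); rewrite ?normr1 ?normr0 ?ler01.
rewrite exprS -mulmxE mxE (le_trans (ler_norm_sum _ _ _)) //.
apply: (@le_trans _ _ ((\sum_l `|M i l|) * c ^+ k)).
  by rewrite mulr_suml; apply: ler_sum => l _; rewrite normrM ler_wpM2l.
rewrite exprS ler_wpM2r ?exprn_ge0 //.
rewrite /c [leRHS](bigD1 i) //= lerDl sumr_ge0 // => i' _; exact: sumr_ge0.
Qed.

Lemma clim_sum (I : Type) (s : seq I) (u : I -> nat -> R[i]) (z : I -> R[i]) :
  (forall i, clim (u i) (z i)) ->
  clim (fun k => \sum_(i <- s) u i k) (\sum_(i <- s) z i).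
Proof.
move=> uz; elim: s => [|i s IHs].
  rewrite big_nil (_ : (fun k => _) = fun=> 0); first exact: clim_cst.
  by apply/funext => k; rewrite big_nil.
rewrite big_cons (_ : (fun k => _) = u i \+ fun k => \sum_(j <- s) u j k).
  exact: climD (uz i) IHs.
by apply/funext => k; rewrite big_cons.
Qed.

Lemma expect_expmx Phi M :
  inner Phi (expmx M *m Phi) = egf (fun k => expect Phi (M ^+ k)).
Proof.
have [K entry_le] := expr_entry_le M.
pose u := series (fun k => (k`!%:R)^-1 *: M ^+ k : 'M[R[i]^o]_n).
have uE i j : (fun N => u N i j) = eseries (fun k => (M ^+ k) i j).
  apply/funext => N; rewrite /u /eseries /series /= summxE.
  by apply: eq_bigr => k _; rewrite mxE.
have u_entry i j : clim (fun N => u N i j) (egf (fun k => (M ^+ k) i j)).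
  by rewrite uE; apply: (@ecvg_le_expr _ _ K) => k; exact: entry_le.
(* Since [expmx] is a limit of matrices, entrywise convergence is first lifted to matrices;
   continuity of the coordinates then identifies the entries of the limit. *)
have u_cvg : cvgn u.
  apply/cvg_ex; exists (\matrix_(i, j) egf (fun k => (M ^+ k) i j)).
  apply/cvg_mx_entourageP => A entA.
  apply: (@filter_forall _ _ (fun i (N : 'M[R[i]^o]_n) => forall j, _)) => i.
  apply: (@filter_forall _ _ (fun j (N : 'M[R[i]^o]_n) => _)) => j.
  rewrite mxE; have near_ij := cvg_entourage (u_entry i j) entA.
  have [N0 _ hN0] := near_ij _.
  by exists N0 => // N N0N; rewrite /= inE; exact: hN0.
have lim_entry i j : clim (fun N => u N i j) (expmx M i j).
  exact: (@cvg_comp _ _ _ u (fun N : 'M[R[i]^o]_n => N i j) _ _ _ u_cvg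
    (@coord_continuous _ n n i j (limn u))).
apply/esym/egfE.
rewrite (_ : eseries _ = fun N => \sum_i \sum_j
    ((Phi i ord0)^* * Phi j ord0) * u N i j); last first.
  apply/funext => N.
  transitivity (expect Phi (u N)).
    rewrite /eseries /u /series /= expect_sum; apply: eq_bigr => k _.
    by rewrite expectZ.
  rewrite /expect innerE; apply: eq_bigr => i _.
  by rewrite mxE mulr_sumr; apply: eq_bigr => j _; rewrite mulrCA mulrC.
rewrite innerE [X in clim _ X](_ : _ = \sum_i \sum_j
    ((Phi i ord0)^* * Phi j ord0) * expmx M i j); last first.
  apply: eq_bigr => i _.
  by rewrite mxE mulr_sumr; apply: eq_bigr => j _; rewrite mulrCA mulrC.
apply: clim_sum => i; apply: clim_sum => j.
exact: (climM (@clim_cst R ((Phi i ord0)^* * Phi j ord0)) (lim_entry i j)).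
Qed.

End MatrixExponential.

(** With [eps = x r^D], [x = exp(t) - 1] and [r = 1 + 1/D], the claim amounts to
    [eps (2D + 1) <= 1]. Now [x <= 2t] and [r^D <= e] give [eps <= 2te], and
    [2D + 1 <= 2D(D + 1) <= eD(D + 1)], so [2 e^2 D (D + 1) t <= 1] suffices. *)
Lemma small_weight (R : realType) (D : nat) (t : R) : (1 <= D)%N ->
  0 <= t -> t <= tLstar R D ->
  1 + (expR t - 1) * (1 + D%:R^-1) ^+ D <=
  (1 + D%:R^-1) * (1 - (expR t - 1) * (1 + D%:R^-1) ^+ D).
Proof.
move=> D1 t0; rewrite /tLstar; set E := expR 1; set c : R := D%:R => tL.
have c1 : 1 <= c by rewrite ler1n.
have E2 : 2 <= E by rewrite (le_trans _ (expR_ge1Dx 1)) // -natr1.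
have cc : 2 <= c * (c + 1) by nra.
have t_le : t * (E * (E * (c * (c + 1)))) <= 2^-1.
  have : t * (2 * E ^+ 2 * c * (c + 1)) <= 1.
    by rewrite -ler_pdivlMr ?div1r // !mulr_gt0 ?exprn_gt0 //; lra.
  by rewrite expr2; lra.
have t_small : t <= 2^-1.
  have : 1 <= E * (E * (c * (c + 1))) by nra.
  by move=> h; apply: le_trans t_le; rewrite ler_peMr.
have x_le : expR t - 1 <= 2 * t.
  (* From [exp(-t) >= 1 - t] comes [exp(t) - 1 <= t exp(t)], and [exp(t) <= 2] because
     [t <= 1/2]. *)
  have := expR_ge1Dx (- t); rewrite expRN => h.
  have et := expR_gt0 t.
  have : (1 - t) * expR t <= 1 by rewrite -ler_pdivlMr // div1r.
  nra.
have x_ge0 : 0 <= expR t - 1 by have := expR_ge1Dx t; lra.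
have rD : (1 + c^-1) ^+ D <= E.
  have -> : E = expR c^-1 ^+ D by rewrite -expRM_natl mulfV // /c pnatr_eq0 -lt0n.
  by rewrite lerXn2r ?nnegrE ?expR_ge0 ?expR_ge1Dx // addr_ge0 // invr_ge0; lra.
have r_ge0 : 0 <= (1 + c^-1) ^+ D by rewrite exprn_ge0 // addr_ge0 // invr_ge0; lra.
set eps := (expR t - 1) * _.
have eps_le : eps <= 2 * t * E by rewrite /eps ler_pM.
have eps_small : eps * (2 * c + 1) <= 1.
  have : 2 * (t * E) * (c * (c + 1)) * E <= 1 by lra.
  have tE : 0 <= t * E by rewrite mulr_ge0 //; lra.
  have : (2 * (t * E)) * (c * (c + 1)) * 2 <= (2 * (t * E)) * (c * (c + 1)) * E.
    by rewrite ler_wpM2l // !mulr_ge0 //; lra.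
  have : eps * (2 * c + 1) <= (2 * (t * E)) * (2 * c + 1).
    by rewrite ler_wpM2r ?mulrA //; lra.
  have : (2 * (t * E)) * (2 * c + 1) <= (2 * (t * E)) * (c * (c + 1) * 2).
    by rewrite ler_wpM2l ?mulr_ge0 //; nra.
  lra.
have ci : c * c^-1 = 1 by rewrite mulfV // gt_eqF //; lra.
have ci0 : 0 <= c^-1 by rewrite invr_ge0; lra.
have : eps * (2 * c + 1) * c^-1 <= c^-1 by rewrite ler_piMl.
have -> : eps * (2 * c + 1) * c^-1 = 2 * eps * (c * c^-1) + eps * c^-1 by ring.
by rewrite ci; lra.
Qed.

(** * Local Hamiltonians and the quantum speed limit *)

Section SpeedLimit.
Import mathcomp.boot.fintype mathcomp.boot.finset.
Variables (R : realType) (V : finType) (d : nat).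
Variables (S : {set {set V}}) (lam : {set V} -> R) (h : {set V} -> oper R d V).
Variable Phi : ket R d V.
Hypothesis lam_le1 : forall X, X \in S -> `|lam X| <= 1.
Hypothesis h_supp : forall X, X \in S -> has_support (h X) X.
Hypothesis h_norm : forall X, X \in S -> opnorm (h X) = 1.
Hypothesis Phi_prod : product_state Phi.

(** The value 0 off [S] makes norm bounds and locality hold for every letter. The scalar [a] is
    [-it] for amplitudes and 1 for the moments of the Hamiltonian. *)
Let term (a : R[i]) X : oper R d V :=
  if X \in S then (a * (lam X)%:C) *: h X else 0.

Let sum_term a : \sum_(X in S) term a X = a *: hamiltonian S lam h.
Proof.
rewrite /hamiltonian scaler_sumr; apply: eq_bigr => X XS.
by rewrite /term XS scalerA.
Qed.

Let term_vnorm a t X u : `|a| = t%:C -> vnorm (term a X *m u) <= t * vnorm u.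
Proof.
move=> at_; have t0 : 0 <= t by rewrite -ler0c -at_.
rewrite /term; case: ifP => XS.
  have lam1 : `|(lam X)%:C| <= 1 :> R[i].
    by rewrite normc_def /= expr0n addr0 sqrtr_sqr lecR lam_le1.
  rewrite -scalemxAl -lecR vnormZ normrM at_ rmorphM /= -mulrA.
  rewrite ler_wpM2l ?ler0c // (le_trans (ler_wpM2r _ lam1)) ?ler0c ?vnorm_ge0 //.
  by rewrite mul1r lecR opnorm1_le // h_norm.
rewrite mul0mx /vnorm /inner mulmx0 mxE sqrtr0 mulr_ge0 //; exact: vnorm_ge0.
Qed.

(** Each factor multiplies the length of a vector by at most [t]; Cauchy-Schwarz against the unit
    vector [Phi] does the rest. *)
Let term_prod_le a t m (w : 'I_m -> {set V}) : `|a| = t%:C ->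
  `|expect Phi (\prod_(i < m) term a (w i))| <= (t ^+ m)%:C.
Proof.
move=> at_; have t0 : 0 <= t by rewrite -ler0c -at_.
have [Phi1 _] := Phi_prod.
rewrite (le_trans (CauchySchwarz_unit _ Phi1)) // lecR.
rewrite -[leRHS]mulr1 -Phi1.
elim: m w => [|m IHm] w; first by rewrite big_ord0 expr0 mul1mx mul1r.
rewrite big_ord_recl -mulmxE -mulmxA exprS -mulrA.
rewrite (le_trans (term_vnorm _ _ at_)) // ler_wpM2l //.
Qed.

Let term_localized a X : localized X (term a X).
Proof.
rewrite /term; case: ifP => XS; last exact: localized0.
by apply: localizedZ; apply: acts_on_localized; have [] := h_supp XS.
Qed.

Let sum_term_localized a (A : {set {set V}}) (U : {set V}) :
  (forall X, X \in A -> X \subset U) -> localized U (\sum_(X in A) term a X).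
Proof.
move=> AU; apply: localized_sum => X XA.
exact: localizedW (AU X XA) (term_localized a X).
Qed.

(** Non-adjacency says nothing when [X = Y]; disjointness of the two families excludes that case. *)
Let cover_disjoint (A B : {set {set V}}) : [disjoint A & B] ->
  (forall X Y, X \in A -> Y \in B -> ~~ interaction_adj X Y) ->
  forall Y, Y \in B -> Y \subset ~: cover A.
Proof.
move=> AB nAB Y YB; rewrite -disjoints_subset.
apply: bigcup_disjoint => X XA; rewrite disjoint_sym.
have := nAB X Y XA YB; rewrite /interaction_adj /= negb_and !negbK.
by case/orP => // /eqP XY; rewrite -XY (disjointFr AB XA) in YB.
Qed.

Let amplitude t : R[i] :=
  inner Phi (expmx ((- 'i%C * t%:C) *: hamiltonian S lam h) *m Phi).

Let norm_it t : 0 <= t -> `|- 'i%C * t%:C| = t%:C :> R[i].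
Proof.
move=> t0; rewrite normrM normrN (ger0_norm (x := t%:C)) ?ler0c //.
by rewrite normc_def /= expr0n expr1n add0r sqrtr1 mul1r.
Qed.

Let amplitudeE t : amplitude t =
  egf (fun m => (- 'i%C * t%:C) ^+ m * expect Phi (hamiltonian S lam h ^+ m)).
Proof.
rewrite /amplitude expect_expmx; congr egf; apply/funext => m.
by rewrite expmxZn expectZ.
Qed.

Lemma amplitude_neq0_le_tLstar t : (1 <= interaction_degree S)%N ->
  0 <= t -> t <= tLstar R (interaction_degree S) -> amplitude t != 0.
Proof.
move=> D1 t0 tL; rewrite /amplitude expect_expmx -sum_term.
have at_ := norm_it t0; set a := - 'i%C * t%:C in at_ *.
have [Phi1 _] := Phi_prod.
(* The two partial Hamiltonians live on complementary subsystems, which yields both commutation and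
   independence. *)
have local_pair (A B : {set {set V}}) : [disjoint A & B] ->
    (forall X Y, X \in A -> Y \in B -> ~~ interaction_adj X Y) ->
    localized (cover A) (\sum_(X in A) term a X) /\
    localized (~: cover A) (\sum_(X in B) term a X).
  move=> AB nAB; split; apply: sum_term_localized; last exact: cover_disjoint.
  by move=> X XA; exact: bigcup_sup XA.
apply: (@amplitude_neq0 R _ _ (@interaction_adj V) S (interaction_degree S) t
  (term a) Phi t0 _ _ _ _ (1 + (interaction_degree S)%:R^-1)).
- by rewrite innervv Phi1 expr1n.
- by move=> m w; exact: term_prod_le.
- move=> A B _ _ AB nAB; have [lA lB] := local_pair A B AB nAB.
  exact: localized_comm lA lB.
- move=> A B _ _ AB nAB j k; have [lA lB] := local_pair A B AB nAB.
  by apply: (product_state_expectM (X := cover A)) => //; exact: localizedX.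
- by rewrite lerDl invr_ge0.
- exact: small_weight.
- move=> Y YS; apply: leq_trans (leq_bigmax_cond _ YS).
  by apply/subset_leq_card/subsetP => X; rewrite !inE.
Qed.

(** Before division by [m!], the degree [m] coefficient of the difference is at most
    [|S|^m (t^m - s^m)]. The resulting continuity in time is what makes the first zero attained. *)
Lemma amplitude_dist s t : 0 <= s -> s <= t ->
  `|amplitude t - amplitude s| <= (expR (#|S|%:R * t) - expR (#|S|%:R * s))%:C.
Proof.
move=> s0 st; have t0 := le_trans s0 st.
have H_le m : `|expect Phi (hamiltonian S lam h ^+ m)| <= (#|S|%:R ^+ m)%:C.
  have n1 : `|1 : R[i]| = 1%:C by rewrite normr1.
  (* Scaling by 1 presents the Hamiltonian as a sum of terms of norm at most 1, so the moment bound
     applies at time 1. *)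
  rewrite -[hamiltonian _ _ _]scale1r -sum_term -[#|S|%:R]mulr1.
  by apply: expect_exp_sum_le => // k w; exact: term_prod_le.
have bound r m : 0 <= r -> `|(- 'i%C * r%:C) ^+ m * expect Phi (hamiltonian S lam h ^+ m)|
    <= ((#|S|%:R * r) ^+ m)%:C.
  move=> r0; rewrite normrM normrX norm_it // exprMn rmorphM /= mulrC rmorphXn /=.
  by rewrite [X in _ <= _ * X]rmorphXn ler_wpM2r ?exprn_ge0 ?ler0c // -rmorphXn.
rewrite !amplitudeE.
have ct := ecvg_le_expr (fun m => bound t m t0).
have cs := ecvg_le_expr (fun m => bound s m s0).
have [cts <-] := egfB ct cs.
apply: (egf_norm_le (g := fun m => (#|S|%:R * t) ^+ m - (#|S|%:R * s) ^+ m)) => //.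
  move=> m; rewrite /= -mulrBl !exprMn -!mulrBr -!rmorphXn -rmorphB.
  rewrite !normrM normrX normrN normc_def /= expr0n expr1n add0r sqrtr1 expr1n mul1r.
  have d0 : 0 <= t ^+ m - s ^+ m by rewrite subr_ge0 lerXn2r.
  by rewrite ger0_norm ?ler0c // rmorphM mulrC natrX ler_wpM2r ?ler0c ?H_le.
suff -> : series (fun k => (k`!%:R)^-1 * ((#|S|%:R * t) ^+ k - (#|S|%:R * s) ^+ k)) =
    series (fun k => (k`!%:R)^-1 * (#|S|%:R * t) ^+ k) \-
    series (fun k => (k`!%:R)^-1 * (#|S|%:R * s) ^+ k).
  exact: cvgB (@cvg_series_expR _ _) (@cvg_series_expR _ _).
by apply/funext => k; rewrite /series /= -sumrB; apply: eq_bigr => j _; rewrite mulrBr.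
Qed.

(** The infimum of a nonempty set of zeros is a zero: there are zeros [t] arbitrarily close above
    it, and by [amplitude_dist] the amplitude at the infimum is at most [f t - f (inf E)] in
    modulus, with [f] continuous. *)
Lemma tQSL_exists : exists T, is_tQSL (hamiltonian S lam h) Phi T.
Proof.
set E := orthogonality_times (hamiltonian S lam h) Phi.
have [E0|] := eqVneq E classical_sets.set0; first by exists +oo%E; right.
move=> /classical_sets.set0P[t1 Et1].
have E_lb : lbound E 0 by move=> t [].
have E_inf : has_inf E by split; [exists t1 | exists 0].
have inf_le s : E s -> inf E <= s by move=> Es; apply: ge_inf Es; exists 0.
have inf0 : 0 <= inf E by apply: lb_le_inf E_lb; exists t1.
exists (inf E)%:E; left; exists (inf E); first by [].
split; last exact: inf_le.
split; first exact: inf0.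
apply/eqP; rewrite -normr_le0 -/(amplitude (inf E)); apply/ler_addgt0Pr => e e0.
have eE : (complex.Re e)%:C = e by rewrite RRe_real // gtr0_real.
pose f t := expR (#|S|%:R * t) : R.
have f_cont : {for inf E, continuous f}.
  apply: continuous_comp; last exact: continuous_expR.
  by apply: cvgM; [exact: cvg_cst | exact: cvg_id].
have : 0 < complex.Re e by rewrite -ltcR eE.
move/(cvgrPdist_lt _ _).1/(_ _): (f_cont) => /[apply] /nbhs_ballP[dlt /= dlt0 ball_f].
have [t Et t_lt] := inf_adherent dlt0 E_inf.
have t_ge := inf_le _ Et.
have /ball_f : ball (inf E) dlt t.
  by rewrite /ball /= distrC ger0_norm ?subr_ge0 // ltrBlDl.
rewrite distrC ger0_norm ?subr_ge0 ?ler_expR ?ler_wpM2l // => ft.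
rewrite add0r -eE (le_trans _ (ltW (_ : (f t - f (inf E))%:C < _))) ?ltcR //.
have := amplitude_dist inf0 t_ge; case: Et => _; rewrite -/(amplitude t) => ->.
by rewrite sub0r normrN.
Qed.

End SpeedLimit.

Theorem corollary16 (R : realType) (V : finType) (d k : nat)
    (S : {set {set V}}) (lam : {set V} -> R) (h : {set V} -> oper R d V)
    (Phi : ket R d V)
    (card_S : forall X, X \in S -> (#|X| <= k)%N)
    (lam_le1 : forall X, X \in S -> `|lam X| <= 1)
    (h_herm : forall X, X \in S -> h X \is hermsymmx)
    (h_supp : forall X, X \in S -> has_support (h X) X)
    (h_norm : forall X, X \in S -> opnorm (h X) = 1)
    (deg_ge1 : (1 <= interaction_degree S)%N)
    (Phi_prod : product_state Phi) :
  exists2 T : \bar R,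
    is_tQSL (hamiltonian S lam h) Phi T &
    ((tLstar R (interaction_degree S))%:E <= T)%E.
Proof.
have [T T_QSL] := tQSL_exists lam_le1 h_norm Phi_prod.
exists T => //; case: T_QSL => [[t -> [[t0 At] _]]|[_ ->]]; last exact: leey.
rewrite lee_fin leNgt; apply/negP => /ltW t_le.
have := amplitude_neq0_le_tLstar lam_le1 h_supp h_norm Phi_prod deg_ge1 t0 t_le.
by rewrite At eqxx.
Qed.
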